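(* Let $G$ be a finite graph on vertex set $V$. The sink sequence map $f$ is a bijection from the set of acyclic orientations of $G$ to the set of stable link sequences of $G$.
   Context: A subset $S\subseteq V$ is stable if no edge of $G$ has both ends in $S$. A stable link sequence of $G$ is an ordered set partition $\sigma=(\sigma_1,\ldots,\sigma_r)$ of $V$ (nonempty blocks) such that each $\sigma_i$ is stable and, for each $v\in V\setminus\sigma_1$, there is an edge of $G$ between $v$ and some element of the block immediately preceding the block containing $v$. For an acyclic orientation $A$ of $G$, its sink sequence $f(A)$ is the ordered set partition defined by: $\sigma_1$ is the set of sinks of $A$, and $\sigma_{k+1}$ is the set of sinks of the restriction of $A$ to $V\setminus(\sigma_1\cup\cdots\cup\sigma_k)$, continued until all vertices are used. *)

(* Defs.v *)
From mathcomp Require Import all_boot.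

Set Implicit Arguments.
Unset Strict Implicit.
Unset Printing Implicit Defensive.

(* Parallel edges and loops are allowed: [ends] need not be injective, and a
   loop at [v] is an edge whose set of ends is [[set v]].  Simple graphs are the
   special case where [ends] is injective with values of cardinal 2. *)
Record graph (V : finType) := Graph {
  edge : finType;
  ends : edge -> {set V};
  card_ends : forall e, 0 < #|ends e| <= 2
}.
Arguments ends {V} g e.

Section Graph.

Variables (V : finType) (G : graph V).

Definition adj (u v : V) : bool := [exists e, ends G e == [set u; v]].

Definition stable (S : {set V}) : bool := [forall e, ~~ (ends G e \subset S)].

(* An orientation is given by the head of each edge. *)
Definition orientation (A : {ffun edge G -> V}) : Prop :=
  forall e, A e \in ends G e.

Definition arc (A : {ffun edge G -> V}) (u v : V) : bool :=
  [exists e, (ends G e == [set u; v]) && (A e == v)].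

(* The directed cycles include those of length 1 (loops) and of length 2
   (parallel edges with opposite directions). *)
Definition acyclic_orientation (A : {ffun edge G -> V}) : Prop :=
  orientation A /\ forall c : seq V, ucycle (arc A) c -> c = [::].

Definition sinks (A : {ffun edge G -> V}) (U : {set V}) : {set V} :=
  [set v in U | [forall u in U, ~~ arc A v u]].

(* [n] bounds the number of blocks produced. *)
Fixpoint sink_sequence_rec (n : nat) (A : {ffun edge G -> V}) (U : {set V}) :
    seq {set V} :=
  if n is n'.+1 then
    if U == set0 then [::]
    else sinks A U :: sink_sequence_rec n' A (U :\: sinks A U)
  else [::].

(* When [A] is acyclic every step removes at least one vertex, so that #|V|
   steps exhaust [V]. *)
Definition sink_sequence (A : {ffun edge G -> V}) : seq {set V} :=
  sink_sequence_rec #|V| A [set: V].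

Definition ordered_set_partition (s : seq {set V}) : bool :=
  uniq s && partition [set B in s] [set: V].

(* Blocks are numbered from 0; [nth set0 s i.+1] is empty past the end. *)
Definition stable_link_sequence (s : seq {set V}) : Prop :=
  [/\ ordered_set_partition s,
      forall B, B \in s -> stable B &
      forall (i : nat) (v : V), v \in nth set0 s i.+1 ->
        exists2 u, u \in nth set0 s i & adj v u].

End Graph.

(* Main.v *)
Require Import Defs.
From mathcomp Require Import all_boot.

(* The first block of the sink sequence can be peeled off: what remains is the
   sink sequence of the orientation restricted to the other vertices, so all
   three parts are proved by induction on the set [U] of remaining vertices.
   An edge meeting the set of sinks of [U] must point to the end lying in it,
   hence the sequence determines the orientation.  Conversely, given a stable
   link sequence, orient every edge towards its end in the earlier block:
   stability makes this strictly decreasing (so acyclic), and the link condition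
   says exactly that no vertex outside the first block is a sink. *)

(** * Ordered partitions of a subset, peeled block by block *)

Section OrderedPartition.

Local Set Implicit Arguments.
Local Unset Strict Implicit.

Variable V : finType.
Implicit Types (U B : {set V}) (s : seq {set V}) (v : V).

(** Relative form of [ordered_set_partition], convertible to it when [U] is [[set: V]]; inductions
    on blocks need an arbitrary ground set. *)
Definition ordered_partition_of U s := uniq s && partition [set B in s] U.

Lemma ordered_partition_of_nil U : ordered_partition_of U [::] = (U == set0).
Proof.
have -> : ordered_partition_of U [::] = partition set0 U.
  by rewrite /ordered_partition_of /=; congr partition; apply/setP=> B; rewrite !inE.
apply/idP/eqP=> [/cover_partition <-|->]; first by rewrite /cover big_set0.
by rewrite partition_set0.
Qed.

Lemma ordered_partition_of_cons U B s :
  ordered_partition_of U (B :: s) =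
  [&& B != set0, B \subset U & ordered_partition_of (U :\: B) s].
Proof.
rewrite /ordered_partition_of /=.
have -> : [set X in B :: s] = B |: [set X in s] by apply/setP=> X; rewrite !inE.
apply/idP/idP.
  case/andP=> /andP[Bs us] pU.
  have BP : B \in B |: [set X in s] by rewrite setU11.
  rewrite us (partition_neq0 pU) //=.
  have -> : B \subset U by rewrite -(cover_partition pU) (bigcup_sup B).
  by have := partitionD1 pU BP; rewrite setU1K // inE.
case/and3P=> B0 BU /andP[us pUB].
have dis : [disjoint B & U :\: B].
  by rewrite -setI_eq0 setIDA setIC -setIDA setDv setI0.
(* A repetition of [B] would lie in its own complement, hence be empty. *)
have Bs : B \notin s.
  apply: contra B0 => Bs.
  have sub : B \subset U :\: B.
    by rewrite -(cover_partition pUB) (bigcup_sup B) // inE.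
  by rewrite -subset0 -(disjoint_setI0 dis) subsetI subxx.
rewrite us Bs /=.
by have := partitionU1 pUB B0 dis; rewrite setDE setUIr setUCr setIT (setUidPr BU).
Qed.

Lemma mem_ordered_partition_of U s v :
  ordered_partition_of U s -> v \in U -> exists i, v \in nth set0 s i.
Proof.
elim: s U => [|B s IHs] U.
  by rewrite ordered_partition_of_nil => /eqP->; rewrite inE.
rewrite ordered_partition_of_cons => /and3P[_ _ ps] vU.
have [vB|vB] := boolP (v \in B); first by exists 0.
by have [|i vi] := IHs _ ps; [rewrite inE vB | exists i.+1].
Qed.

Lemma nth_ordered_partition_of U s i :
  ordered_partition_of U s -> nth set0 s i \subset U.
Proof.
elim: s U i => [|B s IHs] U i; first by rewrite nth_nil sub0set.
rewrite ordered_partition_of_cons => /and3P[_ BU ps].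
by case: i => [|i] //=; apply: subset_trans (IHs _ i ps) (subsetDl _ _).
Qed.

(** By disjointness the first block containing [v] is the only one, so [find] computes the block
    index, later used as a rank. *)
Lemma find_ordered_partition_of U s i v :
  ordered_partition_of U s -> v \in nth set0 s i ->
  find (fun B => v \in B) s = i.
Proof.
elim: s U i => [|B s IHs] U i; first by rewrite nth_nil inE.
rewrite ordered_partition_of_cons => /and3P[_ _ ps].
case: i => [|i] /= vi; first by rewrite vi.
have := subsetP (nth_ordered_partition_of i ps) v vi.
by rewrite inE => /andP[/negPf-> _]; rewrite (IHs _ i ps).
Qed.

End OrderedPartition.

(** * Acyclic orientations and their sinks *)

Section SinkSequence.

Local Set Implicit Arguments.
Local Unset Strict Implicit.

(* [path.v] also defines an [arc]. *)
Local Notation arc := Defs.arc.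

Variables (V : finType) (G : graph V).
Implicit Types (A : {ffun edge G -> V}) (U : {set V}) (e : edge G) (v : V).

Lemma ends_neq0 e : exists v, v \in ends G e.
Proof. by apply/card_gt0P; case/andP: (card_ends e). Qed.

Lemma ends_eq2 e u v :
  u \in ends G e -> v \in ends G e -> u != v -> ends G e = [set u; v].
Proof.
move=> ue ve uv; apply/esym/eqP; rewrite eqEcard cards2 uv.
by case/andP: (card_ends e) => _ ->; rewrite andbT subUset !sub1set ue.
Qed.

Lemma arc_adj A u v : arc A u v -> adj G u v.
Proof. by case/existsP=> e /andP[h _]; apply/existsP; exists e. Qed.

(** A path from [v] back to [u], made repetition-free, would close up with the arc into a directed
    cycle; for a loop the path is empty. *)
Lemma acyclic_arc_connect A u v :
  acyclic_orientation A -> arc A u v -> ~~ connect (arc A) v u.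
Proof.
case=> _ acA uv; apply/negP=> /connectP[p pp def_u].
move: uv; rewrite def_u; case/shortenP: pp => q pq uq _ uv.
suff /acA : ucycle (arc A) (v :: q) by [].
by rewrite /ucycle uq andbT /= rcons_path pq.
Qed.

(* A vertex of [U] reaching the fewest vertices is a sink. *)
Lemma sinks_neq0 A U : acyclic_orientation A -> U != set0 -> sinks A U != set0.
Proof.
move=> acA /set0Pn[x xU].
case: (@arg_minnP _ x (mem U) (fun v => #|connect (arc A) v|) xU) => v vU vmin.
have {}vU : v \in U := vU.
apply/set0Pn; exists v; rewrite inE vU /=; apply/forall_inP=> u uU.
apply/negP=> vu; have := vmin u uU; apply/negP; rewrite -ltnNge.
apply/proper_card/properP; split.
  by apply/subsetP=> w; apply: connect_trans; apply: connect1.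
by exists v; [apply: connect0 | apply: acyclic_arc_connect].
Qed.

Lemma sinks_sub A U : sinks A U \subset U.
Proof. by apply/subsetP=> v; rewrite inE => /andP[]. Qed.

(** Some sink exists, so each recursive step can afford to spend one unit of the bound [n]. *)
Lemma card_setD_sinks A U n :
  acyclic_orientation A -> U != set0 -> #|U| <= n.+1 -> #|U :\: sinks A U| <= n.
Proof.
move=> acA U0 Un; rewrite -ltnS; apply: leq_trans Un; apply: proper_card.
have [v vs] := set0Pn _ (sinks_neq0 acA U0).
apply/properP; split; first exact: subsetDl.
by exists v; [apply: (subsetP (sinks_sub A U)) | rewrite inE vs].
Qed.

(** Otherwise [e] would be an arc from the sink [v] to its head, which is still in [U]. *)
Lemma sinks_head A U e v :
  orientation A -> ends G e \subset U -> v \in ends G e -> v \in sinks A U ->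
  A e = v.
Proof.
move=> oA eU ve; rewrite inE => /andP[_ /forall_inP vsink].
apply/eqP/negPn/negP; rewrite eq_sym => nv.
have /negP[] := vsink (A e) (subsetP eU _ (oA e)).
by apply/existsP; exists e; rewrite eqxx andbT (ends_eq2 ve (oA e)) ?eqxx.
Qed.

(** By [sinks_head] every end of an edge among the sinks is its head, so the edge is a loop, and a
    loop gives its vertex an outgoing arc. *)
Lemma stable_sinks A U : orientation A -> stable G (sinks A U).
Proof.
move=> oA; apply/forallP=> e; apply/negP=> es.
have [v ve] := ends_neq0 e.
have := subsetP es (A e) (oA e).
rewrite inE => /andP[AU /forall_inP /(_ _ AU) /negP[]].
apply/existsP; exists e; rewrite eqxx andbT setUid.
have hd w : w \in ends G e -> A e = w.
  by move=> we; apply: sinks_head (subset_trans es (sinks_sub _ _)) _ (subsetP es _ _).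
apply/eqP/setP=> w; rewrite inE.
by apply/idP/eqP=> [/hd->|->].
Qed.

(** * Sink sequences are stable link sequences *)

Lemma sink_sequence_rec_partition A n U :
  acyclic_orientation A -> #|U| <= n ->
  ordered_partition_of U (sink_sequence_rec n A U).
Proof.
move=> acA; elim: n U => [|n IHn] U /=.
  by rewrite leqn0 cards_eq0 ordered_partition_of_nil.
case: eqP => [->|/eqP U0] Un; first by rewrite ordered_partition_of_nil.
rewrite ordered_partition_of_cons sinks_neq0 // sinks_sub /=.
exact/IHn/card_setD_sinks.
Qed.

Lemma sink_sequence_rec_stable A n U B :
  orientation A -> B \in sink_sequence_rec n A U -> stable G B.
Proof.
move=> oA; elim: n U => [|n IHn] U //=.
case: eqP => // _; rewrite inE => /predU1P[->|/IHn//].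
exact: stable_sinks.
Qed.

(** A vertex that becomes a sink only after the sinks [S] are removed has an arc inside [U], and
    that arc must end in [S]. *)
Lemma sink_sequence_rec_link A n U i v :
  v \in nth set0 (sink_sequence_rec n A U) i.+1 ->
  exists2 u, u \in nth set0 (sink_sequence_rec n A U) i & adj G v u.
Proof.
elim: n U i => [|n IHn] U i; first by rewrite nth_nil inE.
rewrite /=; case: eqP => [_|_]; first by rewrite nth_nil inE.
case: i => [|i] /=; last exact: IHn.
case: n {IHn} => [|n] /=; first by rewrite inE.
case: eqP => _ /=; first by rewrite inE.
set S := sinks A U; rewrite [in X in X -> _]inE => /andP[].
rewrite inE => /andP[vS vU] /forall_inP vsink.
have : ~~ [forall u in U, ~~ arc A v u] by move: vS; rewrite inE vU.
rewrite negb_forall_in => /exists_inP[u uU /negPn vu].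
exists u; last exact: arc_adj vu.
by apply: contraTT vu => uS; apply: vsink; rewrite inE uS.
Qed.

(** * Injectivity *)

Lemma sink_sequence_rec_inj A B n U e :
  acyclic_orientation A -> acyclic_orientation B -> #|U| <= n ->
  sink_sequence_rec n A U = sink_sequence_rec n B U ->
  ends G e \subset U -> A e = B e.
Proof.
move=> acA acB; have [v ve] := ends_neq0 e.
elim: n U => [|n IHn] U.
  by rewrite leqn0 cards_eq0 => /eqP-> _ /subsetP/(_ v ve); rewrite inE.
move=> Un /=; case: eqP => [-> _ /subsetP/(_ v ve)|/eqP U0]; first by rewrite inE.
case=> sAB; rewrite -sAB => rAB eU.
(* Either [e] survives in the remaining set, or it meets the common first block and both
   orientations point to its end [w] there. *)
have [eS|/pred0Pn[w /andP[/= we wS]]] := boolP [disjoint ends G e & sinks A U].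
  apply: (IHn (U :\: sinks A U)) => //; first exact: card_setD_sinks.
  by rewrite subsetD eU.
rewrite (sinks_head acA.1 eU we wS).
by rewrite sAB in wS; rewrite (sinks_head acB.1 eU we wS).
Qed.

(** * Surjectivity *)

Lemma acyclic_of_rank A (r : V -> nat) :
  orientation A -> (forall u v, arc A u v -> r v < r u) -> acyclic_orientation A.
Proof.
move=> oA rA; split=> // -[|x p] // /andP[/= pp _].
have tr : transitive (fun u v => r v < r u).
  by move=> v u w uv vw; apply: ltn_trans vw uv.
have := order_path_min tr (sub_path rA pp).
by move=> /allP/(_ x); rewrite mem_rcons inE eqxx ltnn => /(_ isT).
Qed.

(** The decrease along arcs is phrased with block indices, so that passing to the tail of [s] merely
    shifts both indices by one. *)
Lemma sink_sequence_rec_eq A n U s :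
  orientation A -> #|U| <= n -> ordered_partition_of U s ->
  (forall i v, v \in nth set0 s i.+1 ->
     exists2 u, u \in nth set0 s i & adj G v u) ->
  (forall u v i j, arc A u v -> u \in nth set0 s i -> v \in nth set0 s j ->
     j < i) ->
  sink_sequence_rec n A U = s.
Proof.
move=> oA; elim: s n U => [|B s IHs] n U Un.
  by rewrite ordered_partition_of_nil => /eqP-> _ _; case: n {Un} => //= n; rewrite eqxx.
move=> pBs link dec; have := pBs.
rewrite ordered_partition_of_cons => /and3P[B0 BU ps].
have U0 : U != set0 by apply: contraNneq B0 => U0; rewrite -subset0 -U0.
case: n Un => [|n Un] /=; first by rewrite leqn0 cards_eq0 (negPf U0).
rewrite (negPf U0).
have -> : sinks A U = B.
  apply/setP=> v; rewrite inE; apply/andP/idP=> [[vU /forall_inP vsink]|vB].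
    have [[|i] vi] := mem_ordered_partition_of pBs vU; first by [].
    (* The link edge must point from [v] to [u]: the opposite direction would force [i.+1 < i]. *)
    have [u ui /existsP[e /eqP eE]] := link i v vi.
    have uU : u \in U := subsetP (nth_ordered_partition_of i pBs) u ui.
    have /negP[] := vsink u uU; apply/existsP; exists e.
    rewrite eE eqxx /=; have := oA e; rewrite eE !inE => /orP[|//] Av.
    suff : i.+1 < i by rewrite ltnNge leqnSn.
    apply: dec ui vi; apply/existsP; exists e.
    by rewrite eE setUC eqxx Av.
  have vU := subsetP BU v vB; split=> //; apply/forall_inP=> u uU.
  apply/negP=> vu; have [j uj] := mem_ordered_partition_of pBs uU.
  (* An arc leaving block 0 would reach a block of index below 0. *)
  by have := dec v u 0 j vu vB uj.
congr (_ :: _); apply: IHs ps _ _.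
- rewrite -ltnS; apply: leq_trans Un; apply: proper_card.
  have [v vB] := set0Pn _ B0; apply/properP; split; first exact: subsetDl.
  by exists v; [apply: (subsetP BU) | rewrite inE vB].
- by move=> i v; apply: (link i.+1).
- by move=> u v i j uv ui vj; apply: (dec u v i.+1 j.+1).
Qed.

Lemma sink_sequence_surj s :
  stable_link_sequence G s ->
  exists2 A : {ffun edge G -> V}, acyclic_orientation A & sink_sequence A = s.
Proof.
case=> ps st link; pose r v := find (fun B : {set V} => v \in B) s.
have rP v i : v \in nth set0 s i -> r v = i by apply: find_ordered_partition_of ps.
have [A AP] : exists A : edge G -> V,
    forall e, A e \in ends G e /\ forall u, u \in ends G e -> r (A e) <= r u.
  (* The head of each edge is chosen as an end of least rank. *)
  apply: (@fin_all_exists _ _ (fun e v =>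
    v \in ends G e /\ forall u, u \in ends G e -> r v <= r u)) => e; have [x xe] := ends_neq0 e.
  by case: (@arg_minnP _ x (mem (ends G e)) r xe) => v; exists v.
have oA : orientation (finfun A) by move=> e; rewrite ffunE; case: (AP e).
have rA u v : arc (finfun A) u v -> r v < r u.
  case/existsP=> e /andP[/eqP eE]; rewrite ffunE => /eqP Ae.
  (* Equal ranks would put both ends in one block, against stability; this also excludes loops. *)
  have [_ /(_ u)] := AP e; rewrite eE set21 Ae leq_eqVlt => /(_ isT) /predU1P[ruv|//].
  have [i ui] := mem_ordered_partition_of ps (in_setT u).
  have [j vj] := mem_ordered_partition_of ps (in_setT v).
  have ij : i = j by rewrite -(rP _ _ ui) -(rP _ _ vj).
  (* Stability concerns listed blocks only; [j] is in range because the default block [set0] does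
     not contain [v]. *)
  have js : j < size s.
    by rewrite ltnNge; apply: contraTN vj => /(nth_default set0)->; rewrite inE.
  have /forallP/(_ e)/negP[] := st _ (mem_nth set0 js).
  by rewrite eE subUset !sub1set vj -ij ui.
exists (finfun A); first exact: acyclic_of_rank rA.
apply: sink_sequence_rec_eq ps link _ => //; first by rewrite cardsT.
by move=> u v i j /rA + /rP <- /rP <-.
Qed.

End SinkSequence.

Theorem theorem4p3 (V : finType) (G : graph V) :
  [/\ forall A : {ffun edge G -> V},
        acyclic_orientation A -> stable_link_sequence G (sink_sequence A),
      forall A B : {ffun edge G -> V},
        acyclic_orientation A -> acyclic_orientation B ->
        sink_sequence A = sink_sequence B -> A = B &
      forall s : seq {set V}, stable_link_sequence G s ->
        exists2 A : {ffun edge G -> V}, acyclic_orientation A & sink_sequence A = s].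
Proof.
have cV : #|[set: V]| <= #|V| by rewrite cardsT.
split=> [A acA|A B acA acB eqAB|]; last exact: sink_sequence_surj.
- split; first exact: sink_sequence_rec_partition.
  + by move=> B; apply: sink_sequence_rec_stable acA.1.
  + exact: sink_sequence_rec_link.
- apply/ffunP=> e.
  exact: sink_sequence_rec_inj acA acB cV eqAB (subsetT _).
Qed.
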